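(* Let $M\ge 2$ and $m\ge n\ge 1$ be integers, let $H\in\mathbb{C}^{m\times n}$, $v\in\mathbb{C}^m$, and let $x^*\in\mathbb{C}^n$ be a vector each of whose entries lies in $\{e^{2\pi \mathbf{i} j/M}: j=0,1,\ldots,M-1\}$. Put $r=Hx^*+v$. If the relaxation (CSDP) is tight for problem (P), then there exist real numbers $\lambda_1^*,\ldots,\lambda_n^*$ such that $$[H^{\dagger}v]_i=\lambda_i^*\,x_i^*,\qquad i=1,2,\ldots,n.$$
   Context: Notation: $\mathbf{i}$ is the imaginary unit, $(\cdot)^\dagger$ is the conjugate transpose, $A\bullet B=\mathrm{Re}(\mathrm{Trace}(A^\dagger B))$ for Hermitian $A,B$, and $A\succeq B$ means that $A-B$ is (Hermitian) positive semidefinite. Put $Q=H^\dagger H$ and $c=-H^\dagger r$. Problem (P) (MIMO detection): minimize $\|Hx-r\|_2^2$ over $x\in\mathbb{C}^n$ subject to $|x_i|^2=1$ and $\arg(x_i)\in\{0,2\pi/M,\ldots,2(M-1)\pi/M\}$ for $i=1,\ldots,n$. Since $\|Hx-r\|_2^2=x^\dagger Qx+2\mathrm{Re}(c^\dagger x)+\|r\|_2^2$, (P) is identified, after dropping the constant $\|r\|_2^2$, with minimizing $x^\dagger Qx+2\mathrm{Re}(c^\dagger x)$ under the same constraints; the ''optimal value of (P)'' below refers to this form without the constant. (CSDP): minimize $Q\bullet X+2\mathrm{Re}(c^\dagger x)$ over $x\in\mathbb{C}^n$ and Hermitian $X\in\mathbb{C}^{n\times n}$ subject to $X_{i,i}=1$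 for $i=1,\ldots,n$ and $X\succeq xx^\dagger$. Tightness: a semidefinite relaxation of (P) is called tight for (P) if (1) its optimal value equals the optimal value of (P) (zero gap), and (2) it recovers the true vector $x^*$ of transmitted signals; that is, the $x$-component of every optimal solution of the relaxation equals $x^*$. *)

(* Defs.v *)
From HB Require Import structures.
From mathcomp Require Import all_boot all_order all_algebra.
From mathcomp Require Import sesquilinear spectral complex.
From mathcomp Require Import all_classical all_reals all_analysis.

Set Implicit Arguments.
Unset Strict Implicit.
Unset Printing Implicit Defensive.

Import Order.TTheory GRing.Theory Num.Theory.

Local Open Scope ring_scope.
Local Open Scope complex_scope.
Local Open Scope sesquilinear_scope.
Local Open Scope classical_set_scope.

Section MIMO.
Variable R : realType.
Local Notation C := R[i].

Definition expi (t : R) : C := cos t +i* sin t.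

(* [t] is the argument of [z], taken in [0, 2pi[; unique when z != 0. *)
Definition is_arg (z : C) (t : R) : Prop :=
  0 <= t < 2 * pi /\ z = `|z| * expi t.

Definition frob n (A B : 'M[C]_n) : R := complex.Re (\tr (A ^t* *m B)).

(* The order of R[i] has 0 <= z iff z is real and nonnegative. *)
Definition psdmx n (A : 'M[C]_n) : Prop :=
  A \is hermsymmx /\ forall z : 'cV[C]_n, 0 <= (z ^t* *m A *m z) 0 0.

Definition optimal_value T (F : set T) (f : T -> R) : \bar R :=
  ereal_inf [set (f x)%:E | x in F].

Definition optimal_solution T (F : set T) (f : T -> R) (x : T) : Prop :=
  F x /\ forall y, F y -> f x <= f y.

Section Problems.
Variables (m n : nat) (H : 'M[C]_(m, n)) (r : 'cV[C]_m).

Definition mimo_Q : 'M[C]_n := H ^t* *m H.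
Definition mimo_c : 'cV[C]_n := - (H ^t* *m r).

Definition P_feasible (M : nat) : set 'cV[C]_n :=
  [set x | forall i, `|x i 0| ^+ 2 = 1 /\
     exists2 j : nat, (j < M)%N & is_arg (x i 0) (2 * pi * j%:R / M%:R)].

(* ||Hx - r||^2 without the constant ||r||^2; x^dagger Q x is real, so that
   [complex.Re] only retypes it. *)
Definition P_objective (x : 'cV[C]_n) : R :=
  complex.Re ((x ^t* *m mimo_Q *m x) 0 0) +
  2 * complex.Re ((mimo_c ^t* *m x) 0 0).

Definition CSDP_feasible : set ('cV[C]_n * 'M[C]_n) :=
  [set p | [/\ p.2 \is hermsymmx, forall i, p.2 i i = 1 &
               psdmx (p.2 - p.1 *m p.1 ^t*)]].

Definition CSDP_objective (p : 'cV[C]_n * 'M[C]_n) : R :=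
  frob mimo_Q p.2 + 2 * complex.Re ((mimo_c ^t* *m p.1) 0 0).

Definition CSDP_tight (M : nat) (xs : 'cV[C]_n) : Prop :=
  optimal_value CSDP_feasible CSDP_objective =
    optimal_value (P_feasible M) P_objective /\
  forall p, optimal_solution CSDP_feasible CSDP_objective p -> p.1 = xs.

End Problems.
End MIMO.

(* Main.v *)
Require Import Defs.
From HB Require Import structures.
From mathcomp Require Import all_boot all_order all_algebra.
From mathcomp Require Import sesquilinear spectral complex.
From mathcomp Require Import all_classical all_reals all_analysis.
From mathcomp Require Import ring.

(** The condition on [H^dagger v] is the first-order optimality condition of
    the least-squares objective [f] of (P) on the torus
    [|x_1| = ... = |x_n| = 1].

    (P) has finitely many feasible points, so it has a minimizer [x].  The
    rank-one lift [(x, x x^dagger)] is feasible for (CSDP) with the same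
    objective value; by the zero gap it is optimal there, and by the recovery
    property [x] is the transmitted vector [xs].  Hence
    [(xs, xs xs^dagger)] solves (CSDP) ([CSDP_tight_optimal]).

    Every unimodular [y], whatever its phases, lifts to a feasible point of
    (CSDP) in the same way, so [xs] minimizes [f] over the whole torus.
    Rotating only the i-th entry, [xs_i] to [w xs_i] with [|w| = 1], changes
    [f] by
    [[ |w - 1|^2 Q_ii - 2 Re (conj (w - 1) conj (xs_i) (H^dagger v)_i) ]]
    because [H xs - r = - v] ([P_objectiveD]).  Near [w = 1] the first term is
    of second order and the other one is of first order with slope
    proportional to [Im (conj (xs_i) (H^dagger v)_i)], which must therefore
    vanish ([circle_first_order], [unimodular_minimizer_real]).  The real
    number [conj (xs_i) (H^dagger v)_i] is the required multiplier, since
    [xs_i conj (xs_i) = 1]. *)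

Set Implicit Arguments.
Unset Strict Implicit.
Unset Printing Implicit Defensive.

Import Order.TTheory GRing.Theory Num.Theory.

Local Open Scope ring_scope.
Local Open Scope complex_scope.
Local Open Scope sesquilinear_scope.

Lemma trmxC_mul (C : numClosedFieldType) m n p
    (A : 'M[C]_(m, n)) (B : 'M[C]_(n, p)) :
  (A *m B) ^t* = B ^t* *m A ^t*.
Proof. by rewrite trmx_mul map_mxM. Qed.

Section Complex.
Variable R : realType.
Local Notation C := R[i].
Implicit Types (a w z : C) (t q : R).

Lemma ReD a z : complex.Re (a + z) = complex.Re a + complex.Re z.
Proof. by case: a z => [? ?] [? ?]. Qed.

Lemma ReN a : complex.Re (- a) = - complex.Re a.
Proof. by case: a. Qed.

Lemma Re_trmxC (A : 'M[C]_1) : complex.Re ((A ^t*) 0 0) = complex.Re (A 0 0).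
Proof. by rewrite !mxE; case: (A 0 0). Qed.

Lemma norm_expi t : `|expi t| = 1.
Proof. by rewrite normc_def /= cos2Dsin2 sqrtr1. Qed.

Lemma expi_is_arg t : 0 <= t < 2 * pi -> is_arg (expi t) t.
Proof. by move=> ht; split=> //; rewrite norm_expi mul1r. Qed.

Lemma norm1_mulJ z : `|z| = 1 -> z * z ^* = 1.
Proof. by move=> h; rewrite -sqr_normc h expr1n. Qed.

(** The left-hand side is linear in [w - 1] and the right-hand side quadratic,
    so letting [w] approach 1 along the circle kills the tangential component
    [Im a].  The rational parametrization
    [w = ((1 - s^2) + 2 s i) / (1 + s^2)] turns this into a polynomial
    inequality in [s] and avoids differentiation. *)
Lemma circle_first_order a q :
    (forall w, `|w| = 1 ->
      2 * complex.Re ((w - 1) ^* * a) <=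
      complex.Re ((w - 1) ^* * (w - 1)) * q) ->
  complex.Im a = 0.
Proof.
case: a => a b /= H.
have {}H s : s * b <= s ^+ 2 * (q + a).
  have hs : 0 < 1 + s ^+ 2 by rewrite ltr_pwDl ?sqr_ge0.
  have hs0 := lt0r_neq0 hs.
  pose w : C := (1 - s ^+ 2) / (1 + s ^+ 2) +i* (2 * s / (1 + s ^+ 2)).
  have hw : `|w| = 1.
    rewrite normc_def /=; set u := _ + _.
    suff -> : u = 1 by rewrite sqrtr1.
    by rewrite /u; field.
  have /= := H w hw; set l := 2 * _; set r := _ * q.
  have -> : l = 4 / (1 + s ^+ 2) * (s * b - s ^+ 2 * a) by rewrite /l; field.
  have -> : r = 4 / (1 + s ^+ 2) * (s ^+ 2 * q) by rewrite /r; field.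
  by rewrite ler_pM2l ?divr_gt0// lerBlDr -mulrDr.
have [//|b0] := eqVneq b 0; exfalso.
(* At [s = b / k] the inequality [s b <= s^2 (q + a)] reads [k <= q + a]. *)
pose k := `|q + a| + 1.
have k0 : 0 < k by rewrite ltr_wpDl.
have := H (b / k).
have -> : b / k * b = (b / k) ^+ 2 * k by field; rewrite lt0r_neq0.
rewrite ler_pM2l; last by rewrite exprn_even_gt0//= mulf_neq0// invr_neq0// lt0r_neq0.
by rewrite leNgt (le_lt_trans (ler_norm _))// ltrDl.
Qed.

End Complex.

Section Relaxation.
Variables (R : realType) (m n : nat).
Local Notation C := R[i].
Implicit Types (H : 'M[C]_(m, n)) (r v : 'cV[C]_m) (x d : 'cV[C]_n).

(** The relaxation forgets the phase alphabet: only the moduli matter. *)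
Lemma CSDP_feasible_rank1 x :
  (forall i, `|x i 0| = 1) -> CSDP_feasible (x, x *m x ^t*).
Proof.
move=> hx; split=> /=.
- by apply/is_hermitianmxP; rewrite expr0 scale1r trmxC_mul trmxCK.
- by move=> i; rewrite !mxE big_ord1 !mxE norm1_mulJ.
- rewrite subrr; split=> [|z]; last by rewrite mulmx0 mul0mx mxE.
  by apply/is_hermitianmxP; rewrite expr0 scale1r trmx0 map_mx0.
Qed.

Lemma CSDP_objective_rank1 H r x :
  CSDP_objective H r (x, x *m x ^t*) = P_objective H r x.
Proof.
congr (complex.Re _ + _) => /=.
have -> : mimo_Q H ^t* = mimo_Q H by rewrite trmxC_mul trmxCK.
by rewrite mulmxA mxtrace_mulC mulmxA -/(mimo_Q H) trace_mx11.
Qed.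

Lemma P_minimizer H r M : (0 < M)%N ->
  exists x, optimal_solution (P_feasible (n := n) M) (P_objective H r) x.
Proof.
case: M => // M _.
pose pt (f : {ffun 'I_n -> 'I_M.+1}) : 'cV[C]_n :=
  \col_i expi (2 * pi * (f i : nat)%:R / M.+1%:R).
have Hpt f : P_feasible M.+1 (pt f).
  move=> i; rewrite mxE norm_expi expr1n; split=> //; exists (f i) => //.
  apply: expi_is_arg; rewrite !mulr_ge0 ?invr_ge0 ?pi_ge0//=.
  by rewrite ltr_pdivrMr// ltr_pM2l ?mulr_gt0 ?pi_gt0// ltr_nat.
have [f _ fmin] := @arg_minP _ _ _ [ffun=> ord0] predT (fun f => P_objective H r (pt f)) isT.
exists (pt f); split=> // y Fy.
have hy i : exists j : 'I_M.+1, y i 0 = expi (2 * pi * (j : nat)%:R / M.+1%:R).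
  have [/eqP + [j jM [_ yE]]] := Fy i.
  rewrite sqrp_eq1// => /eqP y1.
  by exists (Ordinal jM); rewrite yE y1 mul1r.
have [g gE] := choice hy.
suff -> : y = pt (finfun g) by exact: fmin.
by apply/colP => i; rewrite mxE ffunE gE.
Qed.

(** Tightness constrains the optimal solutions of (CSDP) without asserting that
    there are any; a minimizer of (P) supplies one, and recovery then
    identifies it. *)
Lemma CSDP_tight_optimal H r M xs : (0 < M)%N -> CSDP_tight H r M xs ->
  optimal_solution (CSDP_feasible (n := n)) (CSDP_objective H r)
    (xs, xs *m xs ^t*).
Proof.
move=> M0 [gap recover].
have [x [Fx xmin]] := P_minimizer H r M0.
have x1 i : `|x i 0| = 1.
  by have [/eqP + _] := Fx i; rewrite sqrp_eq1// => /eqP.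
suff xopt : optimal_solution (@CSDP_feasible R n) (CSDP_objective H r)
    (x, x *m x ^t*).
  by have /= <- := recover _ xopt.
split; first exact: CSDP_feasible_rank1.
move=> p Fp; rewrite CSDP_objective_rank1 -lee_fin.
apply: (@le_trans _ _ (optimal_value (@P_feasible R n M) (P_objective H r))).
  by apply: le_ereal_inf_tmp => _ [y Fy <-]; rewrite lee_fin xmin.
by rewrite -gap; apply: ereal_inf_lbound; exists p.
Qed.

(** Expansion of the least-squares objective around a point [x] whose residual
    [H x - r] is [- v]: the terms linear in [d] containing [x] cancel. *)
Lemma P_objectiveD H v x d :
  P_objective H (H *m x + v) (x + d) =
    P_objective H (H *m x + v) x + complex.Re ((d ^t* *m mimo_Q H *m d) 0 0) -
    2 * complex.Re ((d ^t* *m (H ^t* *m v)) 0 0).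
Proof.
have cE (y : 'cV[C]_n) : complex.Re (((mimo_c H (H *m x + v)) ^t* *m y) 0 0) =
    - complex.Re ((y ^t* *m mimo_Q H *m x) 0 0)
    - complex.Re ((y ^t* *m (H ^t* *m v)) 0 0).
  rewrite -Re_trmxC trmxC_mul trmxCK /mimo_c mulmxN mulmxDr mulmxDr mxE ReN.
  by rewrite mxE ReD opprD /mimo_Q !mulmxA.
have sym : complex.Re ((x ^t* *m mimo_Q H *m d) 0 0) =
    complex.Re ((d ^t* *m mimo_Q H *m x) 0 0).
  by rewrite -Re_trmxC !trmxC_mul !trmxCK mulmxA.
rewrite /P_objective !cE.
have entryD (A B : 'M[C]_1) : (A + B) 0 0 = A 0 0 + B 0 0 by rewrite mxE.
have -> : (x + d) ^t* = x ^t* + d ^t* by rewrite linearD map_mxD.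
rewrite !(mulmxDl, mulmxDr) !entryD !ReD sym.
ring.
Qed.

(** Only rotations of a single entry are tested, which suffices because the
    tangent space of the torus is spanned by these directions. *)
Lemma unimodular_minimizer_real H v x :
    (forall i, `|x i 0| = 1) ->
    (forall y : 'cV[C]_n, (forall i, `|y i 0| = 1) ->
       P_objective H (H *m x + v) x <= P_objective H (H *m x + v) y) ->
  forall i, complex.Im ((x i 0) ^* * (H ^t* *m v) i 0) = 0.
Proof.
move=> x1 xmin i.
apply: (@circle_first_order _ _ (complex.Re (mimo_Q H i i))) => w w1.
set z := w - 1.
pose d : 'cV[C]_n := (z * x i 0) *: delta_mx i 0.
have dJ : d ^t* = (z * x i 0) ^* *: delta_mx 0 i.
  by rewrite linearZ /= map_mxZ trmx_delta map_delta_mx.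
have entryZ (c : C) (A : 'M[C]_1) : (c *: A) 0 0 = c * A 0 0 by rewrite mxE.
have {}xmin : P_objective H (H *m x + v) x <= P_objective H (H *m x + v) (x + d).
  apply: xmin => j; rewrite !mxE eqxx andbT.
  have [->|_] := eqVneq j i; last by rewrite mulr0 addr0.
  have -> : x i 0 + z * x i 0 * 1 = w * x i 0 by rewrite /z; ring.
  by rewrite normrM w1 x1 mulr1.
move: xmin; rewrite P_objectiveD -addrA lerDl subr_ge0.
have -> : (d ^t* *m (H ^t* *m v)) 0 0 = z ^* * ((x i 0) ^* * (H ^t* *m v) i 0).
  by rewrite dJ -scalemxAl entryZ -rowE mxE rmorphM mulrA.
have -> : (d ^t* *m mimo_Q H *m d) 0 0 = z ^* * z * mimo_Q H i i.
  rewrite dJ -!scalemxAl -scalemxAr !entryZ -rowE -colE !mxE rmorphM /=.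
  by rewrite -[RHS]mul1r -(norm1_mulJ (x1 i)); ring.
suff -> : complex.Re (z ^* * z * mimo_Q H i i) =
    complex.Re (z ^* * z) * complex.Re (mimo_Q H i i) by [].
by case: z {d dJ} => a b; case: (mimo_Q H i i) => e f /=; ring.
Qed.

End Relaxation.

Theorem theorem2p2 (R : realType) (M m n : nat)
    (hM : (2 <= M)%N) (hn : (1 <= n)%N) (hmn : (n <= m)%N)
    (H : 'M[R[i]]_(m, n)) (v : 'cV[R[i]]_m) (xs : 'cV[R[i]]_n)
    (hxs : forall i, exists2 j : nat,
       (j < M)%N & xs i 0 = expi (2 * pi * j%:R / M%:R))
    (htight : CSDP_tight H (H *m xs + v) M xs) :
  exists lam : 'I_n -> R, forall i : 'I_n,
    (H ^t* *m v) i 0 = (lam i)%:C * xs i 0.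
Proof.
have M0 : (0 < M)%N by exact: ltn_trans hM.
have x1 i : `|xs i 0| = 1 by have [j _ ->] := hxs i; exact: norm_expi.
have [_ xmin] := CSDP_tight_optimal M0 htight.
exists (fun i => complex.Re ((xs i 0) ^* * (H ^t* *m v) i 0)) => i.
have -> : (complex.Re ((xs i 0) ^* * (H ^t* *m v) i 0))%:C =
    (xs i 0) ^* * (H ^t* *m v) i 0.
  apply/eqP; rewrite eq_complex /= eqxx eq_sym; apply/eqP.
  apply: unimodular_minimizer_real => // y y1.
  have /= := xmin _ (CSDP_feasible_rank1 y1).
  by rewrite !CSDP_objective_rank1.
by rewrite mulrAC [_ ^* * _]mulrC norm1_mulJ// mul1r.
Qed.
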